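(* Let $D=(V,E)$ be a digraph with $n=|V|>1$ vertices and $m=|E|$ arcs, and let $\alpha\in[0,1]$. Let $Z=\sum_{v\in V}(d^+(v))^2$ and let $c_2=\sum_{u,v\in V}A(D)_{uv}A(D)_{vu}$ be the number of closed walks of length $2$ in $D$. Let $\lambda_1,\dots,\lambda_n$ be the eigenvalues of $A_\alpha(D)$ (with algebraic multiplicity), let $x_i=\mathrm{Re}(\lambda_i)$, and let $E(D)=\sum_{i=1}^n|x_i|$ be the low energy. Then $$E(D)\le\sqrt{n\left(\alpha^2 Z+(1-\alpha)^2\,\frac{m+c_2}{2}\right)}.$$ Equality holds if and only if $A_\alpha(D)$ is normal and $|x_1|=|x_2|=\dots=|x_n|$. In particular: (i) if $\alpha=0$, equality holds if and only if $D$ is empty or $D\cong\frac{n}{2}\overleftrightarrow{K_2}$; (ii) if $0<\alpha<1$, equality holds if and only if $D$ is empty; (iii) if $\alpha=1$, equality holds if and only if $D$ is out-regular.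
   Context: A digraph $D=(V,E)$ has a finite nonempty vertex set $V$ and an arc set $E\subseteq V\times V$ without self-loops (an arc $(u,v)\in E$ is written $u\to v$; both $u\to v$ and $v\to u$ may be present). $d^+(v)$ is the out-degree of $v$. The adjacency matrix $A(D)$ has $(u,v)$-entry $1$ if $u\to v$ is an arc and $0$ otherwise; $\mathrm{Deg}(D)$ is the diagonal matrix of out-degrees; $A_\alpha(D)=\alpha\,\mathrm{Deg}(D)+(1-\alpha)A(D)$. The digon $\overleftrightarrow{K_2}$ is the digraph on two vertices with both opposite arcs, and $\frac{n}{2}\overleftrightarrow{K_2}$ is the disjoint union of $n/2$ digons with no further arcs (only possible for $n$ even). An empty digraph has no arcs. $D$ is out-regular if $d^+(v)$ is the same for all $v\in V$. *)

(* Defs.v *)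
From HB Require Import structures.
From mathcomp Require Import all_boot all_order all_algebra.
From mathcomp Require Import reals.
From mathcomp Require Import complex.

Set Implicit Arguments.
Unset Strict Implicit.
Unset Printing Implicit Defensive.

Import Order.TTheory GRing.Theory Num.Theory.
Local Open Scope ring_scope.

Record digraph := Digraph {
  vertex :> finType;
  arc : rel vertex;
  arc_irrefl : irreflexive arc
}.

Definition n_arcs (D : digraph) : nat :=
  #|[set p : D * D | arc p.1 p.2]|.

Definition outdeg (D : digraph) (v : D) : nat := #|[set w | arc v w]|.

Definition empty_digraph (D : digraph) : Prop := forall u v : D, ~~ arc u v.

Definition out_regular (D : digraph) : Prop :=
  forall u v : D, outdeg u = outdeg v.

Definition digraph_iso (D1 D2 : digraph) : Prop :=
  exists2 f : D1 -> D2, bijective f & forall u v, arc (f u) (f v) = arc u v.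

Lemma digon_irrefl : irreflexive (fun a b : bool => a != b).
Proof. by move=> a; rewrite eqxx. Qed.

Definition digon : digraph := Digraph digon_irrefl.

Section Copies.
Variables (k : nat) (D : digraph).

Definition copies_arc : rel ('I_k * D) :=
  fun p q => (p.1 == q.1) && arc p.2 q.2.

Lemma copies_irrefl : irreflexive copies_arc.
Proof. by move=> p; rewrite /copies_arc arc_irrefl andbF. Qed.

(* The disjoint union of k copies of D. *)
Definition copies : digraph := Digraph copies_irrefl.

End Copies.

Section Matrices.
Variables (R : realType) (D : digraph).

(* Rows and columns are indexed through the enumeration of the vertices. *)
Definition adjmx : 'M[R]_#|D| :=
  \matrix_(i, j) (arc (enum_val i : D) (enum_val j))%:R.

Definition degmx : 'M[R]_#|D| :=
  diag_mx (\row_i (outdeg (enum_val i : D))%:R).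

Definition Aalpha (alpha : R) : 'M[R]_#|D| :=
  alpha *: degmx + (1 - alpha) *: adjmx.

Definition AalphaC (alpha : R) : 'M[R[i]]_#|D| :=
  map_mx (real_complex R) (Aalpha alpha).

Definition closed_walks2 : R := \sum_u \sum_v adjmx u v * adjmx v u.

Definition sum_sq_outdeg : R := \sum_(v : D) (outdeg v)%:R ^+ 2.

End Matrices.

(* The lambda i list the eigenvalues of M with algebraic multiplicity. *)
Definition is_spectrum (R : realType) n (M : 'M[R[i]]_n)
    (lambda : 'I_n -> R[i]) : Prop :=
  char_poly M = \prod_(i < n) ('X - (lambda i)%:P).

Definition low_energy (R : realType) n (lambda : 'I_n -> R[i]) : R :=
  \sum_(i < n) `|complex.Re (lambda i)|.

Lemma is_spectrum_exists (R : realType) n (M : 'M[R[i]]_n) :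
  exists lambda, is_spectrum M lambda.
Proof.
have [s Hs] := closed_field_poly_normal (char_poly M).
rewrite (monicP (char_poly_monic M)) scale1r in Hs.
have sz : size s = n.
  by apply/eq_add_S; rewrite -(size_char_poly M) Hs size_prod_XsubC.
by exists (fun i => s`_i); rewrite /is_spectrum Hs (big_nth 0) big_mkord sz.
Qed.

(* Main.v *)
(* Schur triangularization writes A = P^* T P with P unitary, so the Frobenius
   norm of A + A^* is that of T + T^*; its diagonal contributes the sum of the
   (2 Re lambda_i)^2, with equality iff T is diagonal, i.e. iff A is normal.
   Combined with Cauchy-Schwarz this gives the bound and its equality case.
   For normal A, all |Re lambda_i| agree iff (A + A^T)^2 is a scalar matrix,
   a condition on nonnegative entries from which the three particular cases are
   read off combinatorially. *)
Require Import Defs.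
From HB Require Import structures.
From mathcomp Require Import all_boot all_order all_algebra.
From mathcomp Require Import reals.
From mathcomp Require Import complex.
From mathcomp Require Import ring.

Set Implicit Arguments.
Unset Strict Implicit.
Unset Printing Implicit Defensive.

Import Order.TTheory GRing.Theory Num.Theory.
Local Open Scope ring_scope.

(* [arc] alone would be [path.arc]. *)
Local Notation arc := Defs.arc.

(** * Unitary triangularization and the real parts of eigenvalues *)

Lemma char_poly_conj (F : comUnitRingType) n (P Q A : 'M[F]_n) :
  P *m Q = 1%:M -> char_poly (Q *m A *m P) = char_poly A.
Proof.
move=> PQ; have QP := mulmx1C PQ.
rewrite /char_poly /char_poly_mx.
have <- : map_mx polyC Q *m ('X%:M - map_mx polyC A) *m map_mx polyC P
   = 'X%:M - map_mx polyC (Q *m A *m P).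
  rewrite mulmxBr mulmxBl scalar_mxC -(mulmxA _ _ (map_mx _ P)) -map_mxM QP.
  rewrite map_mx1 mulmx1.
  by rewrite !map_mxM.
by rewrite !det_mulmx mulrAC -det_mulmx -map_mxM QP map_mx1 det1 mul1r.
Qed.

Section Unitary.
Local Open Scope sesquilinear_scope.
Variable C : numClosedFieldType.

(** [T] comes from the spectral theorem when [A] is normal and from Schur otherwise. In the second
    case [T] cannot be diagonal, since [A] would then be unitarily diagonalizable, hence normal.
    This choice avoids showing that a normal triangular matrix is diagonal. *)
Lemma unitary_trig n (A : 'M[C]_n) :
  exists P T : 'M[C]_n,
    [/\ P *m P^t* = 1%:M, A = P^t* *m T *m P, is_trig_mx T
      & A \is normalmx = is_diag_mx T].
Proof.
(* Schur's theorem is applied in positive dimension only; size 0 is settled by the absence of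
   indices. *)
case: n => [|n] in A *.
  exists 0, 0; split; try by apply/matrixP=> -[].
    by apply/is_trig_mxP=> -[].
  rewrite (_ : is_diag_mx _); first by apply/normalmxP/matrixP=> -[].
  by apply/is_diag_mxP=> -[].
have [/orthomx_spectral_subproof[[P d] /= Pu ->]|nN] := boolP (A \is normalmx).
  exists P, (diag_mx d); rewrite invmx_unitary //.
  have dd := diag_mx_is_diag d; split=> //; first exact/unitarymxP.
have [P Pu] := Schur A (ltn0Sn n); set T := conjmx P A => tT.
have AE : A = invmx P *m T *m P.
  by rewrite /T -conjVmx ?unitarymx_unit // conjmxK ?unitarymx_unit.
exists P, (conjmx P A); split=> //; first exact/unitarymxP.
  by rewrite -invmx_unitary.
apply/esym/negbTE; apply: contra nN => /diag_mxP[d Td].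
by apply/orthomx_spectral_subproof; exists (P, d); rewrite //= -Td.
Qed.

Definition frob2 n (M : 'M[C]_n) : C := \sum_i \sum_j `|M i j| ^+ 2.

Lemma frob2E n (M : 'M[C]_n) : frob2 M = \tr (M *m M^t*).
Proof.
apply: eq_bigr => i _; rewrite mxE; apply: eq_bigr => j _.
by rewrite !mxE normCK.
Qed.

Lemma frob2_unitary n (P M : 'M[C]_n) :
  P *m P^t* = 1%:M -> frob2 (P^t* *m M *m P) = frob2 M.
Proof.
move=> PP; rewrite !frob2E !trmx_mul !map_mxM trmxCK.
by rewrite -!mulmxA mxtrace_mulC -!mulmxA PP mulmx1 (mulmxA P) PP mul1mx.
Qed.

Lemma add_trmxC_unitary n (P T : 'M[C]_n) :
  let A := P^t* *m T *m P in A + A^t* = P^t* *m (T + T^t*) *m P.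
Proof. by rewrite /= !trmx_mul !map_mxM trmxCK mulmxDr mulmxDl !mulmxA. Qed.

(** The [l i] match the diagonal of [T] only up to order, which is enough for symmetric sums and for
    conditions on all pairs. *)
Lemma spectrum_trig n (P T : 'M[C]_n) (l : 'I_n -> C) :
  P *m P^t* = 1%:M -> is_trig_mx T ->
  char_poly (P^t* *m T *m P) = \prod_i ('X - (l i)%:P) ->
  perm_eq [seq l i | i : 'I_n] [seq T i i | i : 'I_n].
Proof.
move=> PP tT; rewrite char_poly_conj // char_poly_trig // => e.
apply: prod_XsubC_eq; rewrite !big_image /= -e; exact: eq_bigr.
Qed.

Lemma add_conjC2 (x : C) : x + x^* = 2 * 'Re x.
Proof. by rewrite ReE mulrC divfK ?pnatr_eq0. Qed.

(** The diagonal of [T + T^t*] consists of the [2 * 'Re (T i i)], so the inequality just drops the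
    off-diagonal entries. As [T] is lower triangular, nothing cancels in these entries: they all
    vanish exactly when [T] is diagonal. *)
Lemma sum_Re_sq_leif n (A : 'M[C]_n) (l : 'I_n -> C) :
  char_poly A = \prod_i ('X - (l i)%:P) ->
  \sum_i (2 * 'Re (l i)) ^+ 2 <= frob2 (A + A^t*) ?= iff (A \is normalmx).
Proof.
have [P [T [PP -> tT ->]]] := unitary_trig A.
move=> /(spectrum_trig PP tT) ep.
rewrite add_trmxC_unitary frob2_unitary //.
have -> : \sum_i (2 * 'Re (l i)) ^+ 2 = \sum_i (2 * 'Re (T i i)) ^+ 2.
  have -> : \sum_i (2 * 'Re (l i)) ^+ 2 =
     \sum_(x <- [seq l i | i : 'I_n]) (2 * 'Re x) ^+ 2 by rewrite big_image.
  by rewrite (perm_big _ ep) big_image.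
(* Padding with zeros off the diagonal turns the comparison into an entrywise one. *)
have -> : \sum_i (2 * 'Re (T i i)) ^+ 2 =
    \sum_i \sum_j (if i == j then (2 * 'Re (T i i)) ^+ 2 else 0).
  by apply: eq_bigr => i _; rewrite -big_mkcond (big_pred1 i).
have -> : is_diag_mx T =
    [forall i, [forall j, (i == j) || ((T + T^t*) i j == 0)]].
  apply/is_diag_mxP/'forall_forallP => [dT i j|h i j ij].
    case: eqP => //= /eqP ij; rewrite !mxE !dT ?add0r ?conjC0 //.
    by rewrite eq_sym.
  case: (ltngtP i j) => [||/eqP]; last by rewrite (negbTE ij).
    by move: i j {ij}; apply/is_trig_mxP.
  move=> ji; have := h i j; rewrite -val_eqE (negbTE ij) !mxE /=.
  by rewrite [T j i](is_trig_mxP tT) // conjC0 addr0 => /eqP.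
apply: leif_sum => i _; apply: leif_sum => j _.
case: eqP => [<-|_] /=.
  rewrite !mxE add_conjC2 real_normK ?realM ?Creal_Re ?realn //.
  exact/leif_refl.
split; first by rewrite exprn_ge0.
by rewrite eq_sym sqrf_eq0 normr_eq0.
Qed.

(** For diagonal [T], the square of [A + A^t*] is unitarily conjugate to the diagonal matrix of the
    [(2 * |Re T i i|) ^+ 2], and conjugation preserves scalar matrices in both directions. *)
Lemma normal_abs_Re_const n (A : 'M[C]_n) (l : 'I_n -> C) :
  char_poly A = \prod_i ('X - (l i)%:P) -> A \is normalmx ->
  (forall i j, `|'Re (l i)| = `|'Re (l j)|) <->
  (exists c, (A + A^t*) *m (A + A^t*) = c%:M).
Proof.
have [P [T [PP -> tT ->]]] := unitary_trig A.
move=> /(spectrum_trig PP tT) ep /diag_mxP[d Td].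
have PP' := mulmx1C PP.
rewrite add_trmxC_unitary.
have -> : P^t* *m (T + T^t*) *m P *m (P^t* *m (T + T^t*) *m P)
   = P^t* *m ((T + T^t*) *m (T + T^t*)) *m P.
  by rewrite !mulmxA -(mulmxA _ P) PP mulmx1.
have -> : (T + T^t*) *m (T + T^t*) = diag_mx (\row_i (2 * `|'Re (T i i)|) ^+ 2).
  rewrite Td tr_diag_mx map_diag_mx -linearD mulmx_diag; congr diag_mx.
  apply/rowP=> i; rewrite !mxE eqxx mulr1n add_conjC2 -expr2 !exprMn.
  by rewrite real_normK ?Creal_Re.
have hl : (forall i j, `|'Re (l i)| = `|'Re (l j)|) <->
          (forall i j, `|'Re (T i i)| = `|'Re (T j j)|).
  have el := perm_mem ep; split=> h i j.
    have /mapP[i' _ ->] : T i i \in [seq l i | i : 'I_n].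
      by rewrite el; apply/image_f.
    have /mapP[j' _ ->] // : T j j \in [seq l i | i : 'I_n].
    by rewrite el; apply/image_f.
  have /mapP[i' _ ->] : l i \in [seq T i i | i : 'I_n].
    by rewrite -el; apply/image_f.
  have /mapP[j' _ ->] // : l j \in [seq T i i | i : 'I_n].
  by rewrite -el; apply/image_f.
apply: (iff_trans hl); split=> [h|[c h]].
  (* In size 0 no eigenvalue can supply [c], and any value works. *)
  case: n => [|n] in A l P T PP tT ep d Td PP' hl h *.
    by exists 0; apply/matrixP=> -[].
  exists ((2 * `|'Re (T ord0 ord0)|) ^+ 2).
  rewrite (_ : \row_i _ = const_mx ((2 * `|'Re (T ord0 ord0)|) ^+ 2)).
    by rewrite diag_const_mx mul_mx_scalar -scalemxAl PP' scalemx1.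
  by apply/rowP=> i; rewrite !mxE (h i ord0).
have {h} /matrixP h : diag_mx (\row_i (2 * `|'Re (T i i)|) ^+ 2) = c%:M.
  have := congr1 (fun M => P *m M *m P^t*) h.
  rewrite mul_mx_scalar -scalemxAl PP scalemx1 => <-.
  by rewrite !mulmxA PP mul1mx -mulmxA PP mulmx1.
have hc k : (2 * `|'Re (T k k)|) ^+ 2 = c.
  by have := h k k; rewrite !mxE eqxx !mulr1n.
move=> i j; have /eqP := etrans (hc i) (esym (hc j)).
by rewrite eqrXn2 ?mulr_ge0 // => /eqP /mulfI; apply; rewrite pnatr_eq0.
Qed.

End Unitary.

(** * Cauchy-Schwarz and the bound for real matrices *)

Lemma sum_sq_leif (R : realFieldType) n (x : 'I_n -> R) :
  (\sum_i `|x i|) ^+ 2 <= n%:R * \sum_i x i ^+ 2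
    ?= iff [forall i, [forall j, `|x i| == `|x j|]].
Proof.
(* Symmetrizing reduces Cauchy-Schwarz to the mean inequality on each pair [(i, j)], whose equality
   case is [|x i| = |x j|]. *)
have -> : n%:R * \sum_i x i ^+ 2 =
    \sum_i \sum_j (`|x i| ^+ 2 + `|x j| ^+ 2) / 2.
  under [RHS]eq_bigr => i _.
    rewrite -mulr_suml big_split /= sumr_const card_ord; over.
  rewrite -mulr_suml big_split /= sumr_const card_ord sumrMnl -mulr2n.
  rewrite -[_ *+ 2]mulr_natr mulfK ?pnatr_eq0 // -[RHS]mulr_natl; congr (_ * _).
  by apply: eq_bigr => i _; rewrite real_normK ?num_real.
rewrite expr2 mulr_suml; apply: leif_sum => i _.
by rewrite mulr_sumr; apply: leif_sum => j _; apply: leif_mean_square.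
Qed.

Section RealMatrix.
Local Open Scope sesquilinear_scope.
Variables (R : realType) (n : nat).
Implicit Types A : 'M[R]_n.
Local Notation "A %:CM" := (map_mx (real_complex R) A) (at level 2).

Lemma map_mx_complex_inj : injective (fun A => A%:CM).
Proof.
move=> A B /matrixP AB; apply/matrixP=> i j.
by have := AB i j; rewrite !mxE => -[].
Qed.

Lemma map_mx_complex_trC A : A%:CM^t* = A^T%:CM.
Proof.
apply/matrixP=> i j; rewrite !mxE; apply/eqP.
by rewrite eq_complex /= oppr0 !eqxx.
Qed.

Lemma map_mx_complex_normal A :
  A%:CM \is normalmx <-> A *m A^T = A^T *m A.
Proof.
rewrite -(rwP normalmxP) map_mx_complex_trC -!map_mxM.
by split=> [/map_mx_complex_inj|->].
Qed.

Lemma low_energy_leif A (l : 'I_n -> R[i]) :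
  (0 < n)%N -> is_spectrum A%:CM l ->
  low_energy l ^+ 2 <= n%:R * \sum_i \sum_j ((A i j + A j i) / 2) ^+ 2
    ?= iff (A%:CM \is normalmx) &&
      [forall i, [forall j, `|complex.Re (l i)| == `|complex.Re (l j)|]].
Proof.
move=> n_gt0 Al; rewrite andbC; apply: leif_trans; first exact: sum_sq_leif.
have := sum_Re_sq_leif Al; rewrite map_mx_complex_trC -map_mxD.
have -> : \sum_i (2 * 'Re (l i)) ^+ 2 =
    (4 * \sum_i complex.Re (l i) ^+ 2)%:C%C.
  rewrite mulr_sumr rmorph_sum; apply: eq_bigr => i _ /=.
  by rewrite -complexRe exprMn rmorphM rmorphXn rmorph_nat -natrX.
(* The halves in the symmetric part account for the factor 4, which cancels against the one from
   [2 * 'Re]. *)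
have -> : frob2 (A + A^T)%:CM =
    (4 * \sum_i \sum_j ((A i j + A j i) / 2) ^+ 2)%:C%C.
  rewrite mulr_sumr rmorph_sum; apply: eq_bigr => i _ /=.
  rewrite mulr_sumr rmorph_sum; apply: eq_bigr => j _ /=.
  rewrite !mxE -add_Re2_Im2 /= expr0n addr0 expr_div_n -natrX.
  by rewrite mulrC divfK ?pnatr_eq0.
case; rewrite lecR (inj_eq (@complexI R)) => le4 eq4.
have n_mono : {mono *%R n%:R : x y / x <= y :> R}.
  by apply: ler_pM2l; rewrite ltr0n.
rewrite (mono_leif n_mono); split; first by rewrite -(ler_pM2l (_ : 0 < 4)).
by rewrite -eq4 (inj_eq (mulfI _)) ?pnatr_eq0.
Qed.

Lemma normal_abs_Re_const_real A (l : 'I_n -> R[i]) :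
  is_spectrum A%:CM l -> A%:CM \is normalmx ->
  (forall i j, `|complex.Re (l i)| = `|complex.Re (l j)|) <->
  (exists c, (A + A^T) *m (A + A^T) = c%:M).
Proof.
move=> Al An; have := normal_abs_Re_const Al An.
rewrite map_mx_complex_trC -map_mxD -map_mxM => h.
have -> : (exists c, (A + A^T) *m (A + A^T) = c%:M) <->
    exists c, ((A + A^T) *m (A + A^T))%:CM = c%:M.
  split=> -[c].
    by move=> ->; exists c%:C%C; rewrite map_scalar_mx.
  (* The product has real entries, so [c] may be replaced by its real part. *)
  move=> /matrixP e; exists (complex.Re c); apply/matrixP=> i j.
  by have := e i j; rewrite !mxE; case: eqP => _ /(congr1 (@complex.Re R)).
apply: iff_trans h; split=> h i j.
  by rewrite -!complexRe !normc_def /= !expr0n !addr0 !sqrtr_sqr (h i j).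
have := h i j.
by rewrite -!complexRe !normc_def /= !expr0n !addr0 !sqrtr_sqr => -[].
Qed.

End RealMatrix.

(** * Unions of digons as graphs of involutions *)

Lemma digraph_iso_digons (D : digraph) :
  (~~ odd #|D| /\ digraph_iso D (copies (#|D|)./2 digon)) <->
  (exists2 s : D -> D, involutive s & forall u v, arc u v = (v == s u)).
Proof.
split=> [[_ [f [g fK gK] f_arc]]|[s sK s_arc]].
  (* The partner of a vertex lies in the same copy, at the other end. *)
  exists (fun u => g ((f u).1, ~~ (f u).2)) => [u|u v].
    by rewrite gK /= negbK -surjective_pairing fK.
  rewrite -f_arc -(can_eq fK) gK /arc /= /copies_arc /=.
  case: (f u) (f v) => [i b] [j c] /=.
  by rewrite xpair_eqE eq_sym; case: b; case: c.
have s_inj := can_inj sK.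
have sN u : s u != u by have := arc_irrefl u; rewrite s_arc eq_sym => ->.
(* [s] has no fixed point, so [S] takes the lower-ranked vertex of each pair [u], [s u]; [s] then
   swaps [S] with its complement. *)
pose S := [set u | enum_rank u < enum_rank (s u)]%N.
have inS u : (s u \in S) = (u \notin S).
  rewrite !inE sK -leqNgt ltn_neqAle andb_idl // => _.
  by rewrite (inj_eq val_inj) (inj_eq enum_rank_inj).
have cardD : #|D| = (#|S|.*2)%N.
  rewrite -(cardC S) -addnn; congr addn.
  rewrite -(card_imset S s_inj); apply: eq_card => u; rewrite !inE.
  apply/idP/imsetP => [uS|[v vS ->]].
    by exists (s u); rewrite ?sK // inS inE.
  by have := inS v; rewrite vS inE => ->.
rewrite cardD odd_double doubleK; split=> //.
(* The index names a digon through its representative in [S]; the boolean chooses the representative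
   or its partner. *)
pose g (p : 'I_#|S| * bool) : D :=
  if p.2 then s (enum_val p.1) else enum_val p.1.
have g_s p : s (g p) = g (p.1, ~~ p.2) by case: p => i []; rewrite /g /= ?sK.
have g_inj : injective g.
  move=> [i b] [j c]; rewrite /g /=.
  have h (k l : 'I_#|S|) : enum_val k <> s (enum_val l) :> D.
    have lS : enum_val l \in S := enum_valP l.
    by move=> e; have : enum_val k \in S := enum_valP k; rewrite e inS lS.
  case: b; case: c => e; first by rewrite (enum_val_inj (s_inj _ _ e)).
  - by case: (h _ _ (esym e)).
  - by case: (h _ _ e).
  - by rewrite (enum_val_inj e).
have [f gK fK] : bijective g.
  apply: inj_card_bij => //.
  by rewrite cardD card_prod card_ord card_bool muln2.
exists f; first by exists g.
move=> u v; rewrite -[in RHS](fK u) -[in RHS](fK v) s_arc g_s (inj_eq g_inj).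
rewrite /arc /= /copies_arc /=.
case: (f u) (f v) => [i b] [j c] /=.
by rewrite xpair_eqE eq_sym; case: b; case: c.
Qed.

(** * Entries of [Aalpha] indexed by vertices *)

Section DigraphMatrix.
Variables (R : realType) (D : digraph).
Implicit Types (M N : 'M[R]_#|D|) (u v w : D).

Lemma sum_enum_rank (F : 'I_#|D| -> R) : \sum_i F i = \sum_u F (enum_rank u).
Proof. exact/reindex/onW_bij/enum_rank_bij. Qed.

Lemma mulmx_enum_rank M N u v :
  (M *m N) (enum_rank u) (enum_rank v) =
  \sum_w M (enum_rank u) (enum_rank w) * N (enum_rank w) (enum_rank v).
Proof. by rewrite mxE sum_enum_rank. Qed.

Lemma AalphaE (alpha : R) u v :
  Aalpha D alpha (enum_rank u) (enum_rank v) =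
  alpha * (outdeg u)%:R *+ (u == v) + (1 - alpha) * (arc u v)%:R.
Proof.
rewrite !mxE !enum_rankK (inj_eq enum_rank_inj).
by congr (_ + _); rewrite [LHS]mulrnAr.
Qed.

Lemma matrix_enum_rankP M N :
  (forall u v, M (enum_rank u) (enum_rank v) = N (enum_rank u) (enum_rank v)) ->
  M = N.
Proof.
by move=> MN; apply/matrixP=> i j; rewrite -(enum_valK i) -(enum_valK j) MN.
Qed.

Lemma sum_sq_sym_Aalpha (alpha : R) :
  \sum_i \sum_j ((Aalpha D alpha i j + Aalpha D alpha j i) / 2) ^+ 2 =
  alpha ^+ 2 * sum_sq_outdeg R D +
    (1 - alpha) ^+ 2 * (((n_arcs D)%:R + closed_walks2 R D) / 2).
Proof.
have arcsE : (n_arcs D)%:R = \sum_(u : D) \sum_(v : D) (arc u v)%:R :> R.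
  have -> : n_arcs D = (\sum_(u : D) \sum_(v : D) arc u v)%N.
    rewrite pair_bigA /n_arcs -sum1dep_card big_mkcond /=.
    by apply: eq_bigr => p _; case: ifP.
  by rewrite natr_sum; apply: eq_bigr => u _; rewrite natr_sum.
have walksE : closed_walks2 R D =
    \sum_(u : D) \sum_(v : D) (arc u v)%:R * (arc v u)%:R.
  rewrite /closed_walks2 sum_enum_rank; apply: eq_bigr => u _.
  by rewrite sum_enum_rank; apply: eq_bigr => v _; rewrite !mxE !enum_rankK.
have arcsE2 : (n_arcs D)%:R = \sum_(u : D) \sum_(v : D) (arc v u)%:R :> R.
  by rewrite arcsE exchange_big.
have -> : ((n_arcs D)%:R + closed_walks2 R D) / 2 =
  \sum_(u : D) \sum_(v : D) (((arc u v)%:R + (arc v u)%:R) / 2) ^+ 2.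
  (* Counting the arcs once in each direction gives the pair [(u, v)] the term [(a + b + 2ab) / 4],
     which equals [((a + b) / 2) ^+ 2] for [a], [b] in {0, 1}. *)
  have -> : ((n_arcs D)%:R + closed_walks2 R D) / 2 =
     ((n_arcs D)%:R + (n_arcs D)%:R + 2 * closed_walks2 R D) / 4 by field.
  rewrite {1}arcsE arcsE2 walksE mulr_sumr -!big_split mulr_suml.
  apply: eq_bigr => u _; rewrite mulr_sumr -!big_split mulr_suml.
  apply: eq_bigr => v _ /=; case: (arc u v); case: (arc v u) => /=; by field.
rewrite /sum_sq_outdeg !mulr_sumr sum_enum_rank -big_split /=.
apply: eq_bigr => u _.
(* Without loops, the degrees live only on the diagonal and the arcs only off it, so no cross term
   appears. *)
rewrite sum_enum_rank mulr_sumr (bigD1 u) //= [in RHS](bigD1 u) //= addrA.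
rewrite !AalphaE eqxx arc_irrefl /= mulr1n; congr (_ + _); first by field.
apply: eq_bigr => v vu.
rewrite !AalphaE [u == v]eq_sym (negbTE vu) /= mulr0n; by field.
Qed.

Lemma sym_sq_scalar_entry (alpha c : R) u v :
  let w x y := alpha * (outdeg x)%:R *+ (x == y) + (1 - alpha) * (arc x y)%:R in
  let A := Aalpha D alpha in
  (A + A^T) *m (A + A^T) = c%:M ->
  \sum_x (w u x + w x u) * (w x v + w v x) = c *+ (u == v).
Proof.
move=> w A /(congr1 (fun M : 'M_#|D| => M (enum_rank u) (enum_rank v))).
rewrite mulmx_enum_rank [in RHS]mxE (inj_eq enum_rank_inj) => <-.
have symE x y : (A + A^T) (enum_rank x) (enum_rank y) = w x y + w y x.
  by rewrite mxE [A^T _ _]mxE /A !AalphaE.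
by apply: eq_bigr => x _; rewrite !symE.
Qed.

(** * Digraphs for which the symmetrized matrix has scalar square *)

Lemma Aalpha_empty (alpha : R) : empty_digraph D -> Aalpha D alpha = 0.
Proof.
move=> D0; apply: matrix_enum_rankP => u v; rewrite AalphaE mxE.
rewrite (negbTE (D0 u v)) mulr0 addr0 /outdeg.
by rewrite eq_card0 ?mulr0 ?mul0rn // => w; rewrite inE (negbTE (D0 u w)).
Qed.

(* An arc [u -> v] makes the [(u, v)] entry of the square positive, through
   the loop of weight [2 alpha d(u)] at [u]. *)
Lemma sym_sq_scalar_empty (alpha c : R) :
  0 < alpha < 1 ->
  (Aalpha D alpha + (Aalpha D alpha)^T) *m
    (Aalpha D alpha + (Aalpha D alpha)^T) = c%:M ->
  empty_digraph D.
Proof.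
move=> /andP[a_gt0 a_lt1] /sym_sq_scalar_entry h u v; apply/negP => uv.
have uNv : (u == v) = false.
  by apply/eqP => e; move: uv; rewrite e arc_irrefl.
have b_gt0 : 0 < 1 - alpha by rewrite subr_gt0.
have w_ge0 x y :
    0 <= alpha * (outdeg x)%:R *+ (x == y) + (1 - alpha) * (arc x y)%:R.
  by rewrite addr_ge0 ?mulrn_wge0 ?mulr_ge0 ?ler0n ?ltW.
have := h u v; rewrite uNv mulr0n => /eqP.
rewrite psumr_eq0 => [/allP/(_ u)|x _]; last first.
  by apply: mulr_ge0; apply: addr_ge0; apply: w_ge0.
rewrite mem_index_enum eqxx uNv arc_irrefl uv => /(_ isT) /=.
have d_gt0 : 0 < (outdeg u)%:R :> R.
  by rewrite ltr0n; apply/card_gt0P; exists v; rewrite inE.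
rewrite gt_eqF //= mulr0 mulr1 mulr1n mulr0n addr0 add0r.
rewrite mulr_gt0 //; first by rewrite addr_gt0 ?mulr_gt0.
rewrite ltr_wpDr // eq_sym uNv mulr0n add0r mulr_ge0 ?ler0n ?ltW //.
Qed.

Lemma Aalpha1 : Aalpha D (1 : R) = degmx R D.
Proof. by rewrite /Aalpha scale1r subrr scale0r addr0. Qed.

Lemma degmx_normal : degmx R D *m (degmx R D)^T = (degmx R D)^T *m degmx R D.
Proof. by rewrite tr_diag_mx. Qed.

Lemma sym_sq_degmx_scalar :
  (exists c, (degmx R D + (degmx R D)^T) *m (degmx R D + (degmx R D)^T) = c%:M)
  <-> out_regular D.
Proof.
rewrite tr_diag_mx -linearD mulmx_diag; split=> [[c /matrixP e] u v|reg].
  have h (x : D) : (2 * (outdeg x)%:R) ^+ 2 = c.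
    have := e (enum_rank x) (enum_rank x).
    by rewrite !mxE eqxx !mulr1n enum_rankK => <-; ring.
  have /eqP := etrans (h u) (esym (h v)).
  rewrite eqrXn2 ?mulr_ge0 ?ler0n // => /eqP/mulfI.
  by rewrite pnatr_eq0 => /(_ isT) /eqP; rewrite eqr_nat => /eqP.
(* The common degree is read at some vertex [v]; without vertices any [c] will do. *)
case: (pickP D) => [v _|D0].
  exists ((2 * (outdeg v)%:R) ^+ 2); apply/matrixP=> i j; rewrite !mxE.
  by congr (_ *+ _); rewrite (reg _ v); ring.
by exists 0; apply/matrixP=> i; have := D0 (enum_val i).
Qed.

Lemma adj_entry u v :
  Aalpha D (0 : R) (enum_rank u) (enum_rank v) = (arc u v)%:R.
Proof. by rewrite AalphaE mul0r mul0rn add0r subr0 mul1r. Qed.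

(** [A] is the permutation matrix of an involution: it is symmetric with square 1, so [A + A^T = 2A]
    has square 4. *)
Lemma digons_adj (s : D -> D) :
  involutive s -> (forall u v, arc u v = (v == s u)) ->
  let A := Aalpha D (0 : R) in
  A *m A^T = A^T *m A /\ exists c, (A + A^T) *m (A + A^T) = c%:M.
Proof.
move=> sK s_arc A.
have AT : A^T = A.
  apply: matrix_enum_rankP => u v; rewrite mxE !adj_entry !s_arc.
  by rewrite eq_sym -(inj_eq (can_inj sK)) sK.
have AA : A *m A = 1%:M.
  apply: matrix_enum_rankP => u v; rewrite mulmx_enum_rank mxE.
  rewrite (bigD1 (s u)) //= big1 => [|x xu]; last first.
    by rewrite adj_entry s_arc (negbTE xu) mul0r.
  rewrite !adj_entry !s_arc sK eqxx mul1r addr0 (inj_eq enum_rank_inj).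
  by rewrite eq_sym.
rewrite AT; split=> //; exists 4.
by rewrite mulmxDl mulmxDr AA -!raddfD; congr _%:M; ring.
Qed.

(* The symmetric part has nonnegative entries, so a diagonal square forces each
   vertex to have at most one neighbour; a scalar one forces exactly one as soon
   as some arc exists, and normality (in-degree = out-degree) makes it a
   digon. *)
Lemma adj_digons (c : R) :
  let A := Aalpha D (0 : R) in
  A *m A^T = A^T *m A -> (A + A^T) *m (A + A^T) = c%:M ->
  empty_digraph D \/
  exists2 s : D -> D, involutive s & forall u v, arc u v = (v == s u).
Proof.
move=> A nA /sym_sq_scalar_entry h.
pose g (x y : D) : R := (arc x y)%:R + (arc y x)%:R.
have {}h u v : \sum_x g u x * g x v = c *+ (u == v).
  rewrite -h; apply: eq_bigr => x _.
  by rewrite !mul0r !mul0rn !add0r subr0 !mul1r.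
have g_ge0 x y : 0 <= g x y by rewrite addr_ge0 ?ler0n.
have g_gt0 x y : (0 < g x y) = arc x y || arc y x.
  by rewrite /g -natrD ltr0n; case: (arc x y); case: (arc y x).
have gC x y : g x y = g y x by rewrite /g addrC.
case: (pickP (fun p : D * D => arc p.1 p.2)) => [[a b] /= ab|D0]; last first.
  by left=> u v; rewrite (D0 (u, v)).
right.
(* The diagonal entry at [a] contains the positive term [g a b * g b a]. *)
have c_gt0 : 0 < c.
  have := h a a; rewrite eqxx mulr1n => <-.
  have ab_gt0 : 0 < g a b by rewrite g_gt0 ab.
  rewrite (bigD1 b) //= ltr_wpDr //; last by rewrite gC mulr_gt0 // gC.
  by apply: sumr_ge0 => x _; rewrite mulr_ge0.
(* A common neighbour [x] of distinct [u] and [v] would make the off-diagonal entry [(u, v)]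
   positive. *)
have nbr_uniq u x v : 0 < g u x -> 0 < g x v -> u = v.
  move=> ux xv; apply/eqP/negPn/negP => /negbTE uv.
  have := h u v; rewrite uv mulr0n => /eqP.
  rewrite psumr_eq0 => [/allP/(_ x)|y _]; last by rewrite mulr_ge0.
  by rewrite mem_index_enum gt_eqF ?mulr_gt0 // => /(_ isT).
(* A vertex without neighbours has a zero row, which would force [c = 0]. *)
have nbr_ex u : exists x, 0 < g u x.
  apply/existsP; apply: contraPT c_gt0 => /existsPn u0; apply/negP.
  have := h u u; rewrite eqxx mulr1n => <-.
  rewrite big1 ?ltxx // => x _.
  by have := u0 x; rewrite lt_def g_ge0 andbT negbK => /eqP->; rewrite mul0r.
(* Entries being 0 or 1, the diagonals of [A *m A^T] and [A^T *m A] hold the out-degrees and the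
   in-degrees. *)
have deg u : \sum_x (arc u x)%:R = \sum_x (arc x u)%:R :> R.
  have := congr1 (fun M : 'M_#|D| => M (enum_rank u) (enum_rank u)) nA.
  rewrite !mulmx_enum_rank => e.
  transitivity (\sum_w A (enum_rank u) (enum_rank w) *
                       A^T (enum_rank w) (enum_rank u)).
    apply: eq_bigr => x _; rewrite [A^T _ _]mxE !adj_entry.
    by case: (arc u x); rewrite ?mul1r ?mul0r.
  rewrite e; apply: eq_bigr => x _; rewrite [A^T _ _]mxE !adj_entry.
  by case: (arc x u); rewrite ?mul1r ?mul0r.
(* As [x] is the only neighbour of [u], both degrees of [u] reduce to their term at [x]. *)
have nbr_digon u x : 0 < g u x -> arc u x = arc x u.
  move=> ux; have := deg u; rewrite (bigD1 x) //= [in RHS](bigD1 x) //=.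
  rewrite !big1 => [|y yx|y yx]; first 1 last.
  - case yu : (arc y u) => //; case/eqP: yx; apply: (nbr_uniq y u x) => //.
    by rewrite g_gt0 yu.
  - case uy : (arc u y) => //; case/eqP: yx; apply: (nbr_uniq y u x) => //.
    by rewrite g_gt0 uy orbT.
  rewrite !addr0 => /eqP; rewrite eqr_nat.
  by case: (arc u x); case: (arc x u).
have [s s_nbr] := fin_all_exists nbr_ex.
have arcE u v : arc u v = (0 < g u v).
  apply/idP/idP => [uv|uv]; first by rewrite g_gt0 uv.
  by move: (uv); rewrite g_gt0 -(nbr_digon u v uv) orbb.
have gE u v : (0 < g u v) = (v == s u).
  apply/idP/eqP => [uv|->//].
  by apply: (nbr_uniq v u (s u)); rewrite // gC.
exists s => [u|u v]; last by rewrite arcE gE.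
by apply/esym/eqP; rewrite -gE gC.
Qed.

End DigraphMatrix.

(** * The bound and its equality cases *)

Theorem corollary4p2 (R : realType) (D : digraph) (alpha : R)
    (lambda : 'I_#|D| -> R[i])
    (hn : (1 < #|D|)%N) (halpha : 0 <= alpha <= 1)
    (hlambda : is_spectrum (AalphaC D alpha) lambda) :
  let E := low_energy lambda in
  let B := Num.sqrt (#|D|%:R *
     (alpha ^+ 2 * sum_sq_outdeg R D +
      (1 - alpha) ^+ 2 * (((n_arcs D)%:R + closed_walks2 R D) / 2))) in
  [/\ E <= B,
      E = B <->
        AalphaC D alpha \is normalmx /\
        (forall i j, `|complex.Re (lambda i)| = `|complex.Re (lambda j)|),
      alpha = 0 ->
        (E = B <->
           empty_digraph D \/
           (~~ odd #|D| /\ digraph_iso D (copies (#|D|)./2 digon))),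
      0 < alpha < 1 -> (E = B <-> empty_digraph D)
    & alpha = 1 -> (E = B <-> out_regular D)].
Proof.
move=> E B.
have n_gt0 : (0 < #|D|)%N := ltnW hn.
have [le_E eq_E] := low_energy_leif n_gt0 hlambda.
rewrite -/E sum_sq_sym_Aalpha in le_E eq_E.
have E_ge0 : 0 <= E by apply: sumr_ge0.
(* The radicand dominates [E ^+ 2], hence is nonnegative and [B ^+ 2] recovers it. *)
have B2_ge0 := le_trans (exprn_ge0 2 E_ge0) le_E.
have eq_EB : E = B <->
    AalphaC D alpha \is normalmx /\
    (forall i j, `|complex.Re (lambda i)| = `|complex.Re (lambda j)|).
  have -> : (E = B) <-> (E ^+ 2 == #|D|%:R * (alpha ^+ 2 * sum_sq_outdeg R D +
      (1 - alpha) ^+ 2 * (((n_arcs D)%:R + closed_walks2 R D) / 2))).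
    split=> [->|/eqP e]; first by rewrite sqr_sqrtr.
    by rewrite /B -e sqrtr_sqr ger0_norm.
  rewrite eq_E; split=> [/andP[nA /'forall_'forall_eqP h]|[nA h]] //.
  by rewrite nA; apply/'forall_'forall_eqP.
(* This form of the equality case no longer mentions the eigenvalues; the three particular cases
   start from it. *)
have eq_EB2 : E = B <->
    let A := Aalpha D alpha in
    A *m A^T = A^T *m A /\ exists c, (A + A^T) *m (A + A^T) = c%:M.
  rewrite eq_EB; split=> -[nA h].
    by split; [apply/map_mx_complex_normal
              | apply/(normal_abs_Re_const_real hlambda)].
  have {}nA : AalphaC D alpha \is normalmx by apply/map_mx_complex_normal.
  by split=> //; apply/(normal_abs_Re_const_real hlambda nA).
have eq_EB_empty : empty_digraph D -> E = B.
  move=> /(Aalpha_empty alpha) A0; apply/eq_EB2; rewrite /= A0 trmx0 mulmx0.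
  by split=> //; exists 0; rewrite addr0 mulmx0 raddf0.
split=> //.
- by rewrite -(@ler_pXn2r _ 2) ?nnegrE ?sqrtr_ge0 // sqr_sqrtr.
- move=> alpha0; rewrite digraph_iso_digons.
  split=> [/eq_EB2|[/eq_EB_empty//|[s sK s_arc]]].
    by rewrite alpha0 => -[nA [c hc]]; apply: adj_digons nA hc.
  by apply/eq_EB2; rewrite alpha0; apply: digons_adj sK s_arc.
- move=> alpha01; split=> [/eq_EB2[_ [c]]|//].
  exact: sym_sq_scalar_empty.
- move=> alpha1; rewrite eq_EB2 alpha1 Aalpha1 /=.
  split=> [[_]|reg]; first by move/sym_sq_degmx_scalar.
  by split; [apply: degmx_normal | apply/sym_sq_degmx_scalar].
Qed.
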